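(* Let $A$ be a connected graded algebra over a field $k$, finitely generated in degree 1, and let $E$ be the $A_\infty$-algebra $\mathrm{Ext}^*_A(k_A,k_A)$. Let $R=\bigoplus_{n\ge2}R_n$ be a minimal graded space of relations of $A$, chosen so that $R_n\subset A_1\otimes A_{n-1}\subset A_1^{\otimes n}$. For each $n\ge2$, let $i_n:R_n\to A_1^{\otimes n}$ be the inclusion map and let $i_n^{\#}$ be its $k$-linear dual. Then the multiplication $m_n$ of $E$ restricted to $(E^1)^{\otimes n}$ is equal to the map $$i_n^{\#}:(E^1)^{\otimes n}=(A_1^{\#})^{\otimes n}\longrightarrow R_n^{\#}\subset E^2.$$
   Context: All algebras and vector spaces are over a field $k$. A connected graded algebra is $A=k\oplus A_1\oplus A_2\oplus\cdots$ (associative, unital); $\mathfrak m=\bigoplus_{i\ge1}A_i$. $k_A$ is the trivial right module $A/\mathfrak m$. The grading induced from $A$ is the Adams grading, written as a subscript; the (co)homological grading is a superscript. $V^{\#}$ is the graded $k$-linear dual. **Generators and relations.** Here $A$ is generated by the finite-dimensional space $A_1$. For $s\ge2$ choose linear maps $\xi_s:A_s\to A_1\otimes A_{s-1}$ splitting multiplication, and define embeddings $\theta_s:A_s\to A_1^{\otimes s}$ splitting multiplication by $\theta_1=\mathrm{id}$, $\theta_s=(\mathrm{id}_{A_1}\otimes\theta_{s-1})\circ\xi_s$. Through $\mathrm{id}\otimes\theta_{n-1}$, $A_1\otimes A_{n-1}$ is viewed as a subspace of $A_1^{\otimes n}$. A minimal graded space of relations is a minimal graded subspace $R$ of the tensor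 algebra $T\langle A_1\rangle$ generating, as a two-sided ideal, the kernel of $T\langle A_1\rangle\to A$. There are natural isomorphisms $E^1=\mathrm{Ext}^1_A(k_A,k_A)\cong A_1^{\#}$ and $E^2=\mathrm{Ext}^2_A(k_A,k_A)\cong R^{\#}=\bigoplus R_n^{\#}$. **$A_\infty$-algebras.** An $A_\infty$-algebra is a $\mathbb Z$-graded vector space $A=\bigoplus_p A^p$ with graded maps $m_n:A^{\otimes n}\to A$ $(n\ge1)$ of degree $2-n$ such that for all $n\geq 1$, $\sum(-1)^{r+st}m_u(\mathrm{id}^{\otimes r}\otimes m_s\otimes\mathrm{id}^{\otimes t})=0$, summed over $n=r+s+t$, $r,t\ge0$, $s\ge1$, with $u=r+1+t$ (Koszul signs when applied to elements). If there is an Adams grading, all $m_n$ preserve it. **Merkulov's construction.** For a DG algebra $(T,\partial)$ let $B^n$, $Z^n$ be the coboundaries and cocycles, and choose subspaces (compatible with Adams grading) with $Z^n=B^n\oplus H^n$, $T^n=B^n\oplus H^n\oplus L^n$. Identify the cohomology $HT$ with $\bigoplus H^n$, let $p$ be the projection onto it, and let $G^n:T^n\to T^{n-1}$ be zero on $H^n\oplus L^n$ and $(\partial^{n-1}|_{L^{n-1}})^{-1}$ on $B^n$. Set formally $G\lambda_1=-\mathrm{id}$, let $\lambda_2$ be multiplication, and $\lambda_n=\sum_{s+t=n,\,s,t\ge1}(-1)^{s+1}\lambda_2(G\lambda_s\otimes G\lambda_t)$ for $n\ge3$. Then $m_1=0$ and $m_n=p\lambda_n$ ($n\ge2$) make $HT$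 an $A_\infty$-algebra, a Merkulov model of $T$; all Merkulov models of $T$ are quasi-isomorphic. **The $A_\infty$-algebra $E$.** Let $BA=\bigoplus_{n\ge0}\mathfrak m^{\otimes n}$ be the bar construction, with $\mathfrak m^{\otimes n}$ in degree $-n$, deconcatenation coproduct, and $d[a_1|\cdots|a_n]=\sum_{i=2}^n(-1)^{i-1}[a_1|\cdots|a_{i-1}a_i|\cdots|a_n]$. Its graded dual $B^{\#}A$, a tensor algebra on $S^{-1}\mathfrak m^{\#}$ (i.e. $\mathfrak m^{\#}$ placed in degree 1), is a DG algebra with $\partial(f)=-(-1)^{\deg f}f\circ d$; it is quasi-isomorphic to $\mathrm{End}_A(P_A)$ for any free resolution $P_A$ of $k_A$, and its cohomology is $\mathrm{Ext}^*_A(k_A,k_A)$. This gives $E$ an $A_\infty$-structure, well defined up to quasi-isomorphism. The model of $E$ meant here is the Merkulov model of $B^{\#}A$ attached to the choices above: in degree 1, $H^1=A_1^{\#}$ and $L^1_{-s}=A_s^{\#}$ for $s\ge2$; in degree 2, the decomposition dual to $\bigoplus_{1\le i\le s-1}A_i\otimes A_{s-i}=\mathrm{im}(d^{-3}_s)\oplus R_s\oplus\xi_s(A_s)$, namely $B^2_{-s}=(\xi_s(A_s))^{\#}$, $H^2_{-s}=R_s^{\#}$, $L^2_{-s}=(\mathrm{im}\,d^{-3}_s)^{\#}$, where $d^{-3}_s$ is the component of $d$ from $\mathfrak m^{\otimes3}$ to $\mathfrak m^{\otimes2}$ in Adams degree $s$ and $R_s\subset A_1\otimes A_{s-1}$.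 *)

(* Defs.v *)
From HB Require Import structures.
From mathcomp Require Import all_boot all_order all_algebra.
From mathcomp Require Import generic_quotient.
From mathcomp Require Import boolp classical_sets functions.

Set Implicit Arguments.
Unset Strict Implicit.
Unset Printing Implicit Defensive.

Import GRing.Theory.
Local Open Scope ring_scope.
Local Open Scope quotient_scope.
Local Open Scope classical_set_scope.

Section Subspaces.
Variables (k : fieldType) (V : lmodType k).

Definition subspace (U : set V) : Prop :=
  U 0 /\ forall (c : k) x y, U x -> U y -> U (c *: x + y).

Definition lspan (S : set V) : set V :=
  [set v | exists (t : seq (k * V)),
     (forall cx, cx \in t -> S cx.2) /\ v = \sum_(cx <- t) cx.1 *: cx.2].

Definition is_dsum (W U U' : set V) : Prop :=
  W = [set u + u' | u in U & u' in U'] /\ (forall x, U x -> U' x -> x = 0).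

Definition fin_dim : Prop :=
  exists (d : nat) (e : 'I_d -> V),
    forall v, exists c : 'I_d -> k, v = \sum_(i < d) c i *: e i.

Lemma span0 (S : set V) : lspan S 0.
Proof. by exists [::]; split=> //; rewrite big_nil. Qed.

Lemma span_base (S : set V) x : S x -> lspan S x.
Proof.
move=> Sx; exists [:: (1, x)]; split; last by rewrite big_seq1 scale1r.
by move=> cx; rewrite inE => /eqP ->.
Qed.

Lemma spanP (S : set V) (c : k) x y :
  lspan S x -> lspan S y -> lspan S (c *: x + y).
Proof.
move=> [t [St ->]] [t' [St' ->]].
exists ([seq (c * p.1, p.2) | p <- t] ++ t'); split.
  move=> p; rewrite mem_cat => /orP[/mapP[q qt ->]|]; last exact: St'.
  exact: St qt.
rewrite big_cat big_map /= scaler_sumr; congr (_ + _).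
by apply: eq_bigr => p _; rewrite scalerA.
Qed.

End Subspaces.

(* The k-module with generators x in X in which two formal combinations are
   identified as soon as every map X -> U in the class P (U any k-module) takes
   the same value on both: it is universal for the maps of class P.  Tensor
   products and tensor algebras are the cases where P is bi- or
   multilinearity. *)
Section UniversalModule.
Variables (k : fieldType) (X : choiceType).
Variable P : forall U : lmodType k, (X -> U) -> Prop.

Definition comb_eval (U : lmodType k) (phi : X -> U) (t : seq (k * X)) : U :=
  \sum_(cx <- t) cx.1 *: phi cx.2.

Definition comb_eqv (t t' : seq (k * X)) : bool :=
  `[< forall (U : lmodType k) (phi : X -> U), P phi ->
        comb_eval phi t = comb_eval phi t' >].

Lemma comb_eqv_is_equiv : equiv_class_of comb_eqv.
Proof.
split=> [t|t t'|t' t t''].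
- by apply/asboolP.
- by apply: asbool_equiv_eq; split=> h U phi Pphi; rewrite h.
- move=> /asboolP h /asboolP h'; apply/asboolP => U phi Pphi.
  by rewrite h // h'.
Qed.

Canonical comb_eqv_equiv := EquivRelPack comb_eqv_is_equiv.

Definition umod : Type := {eq_quot comb_eqv}.
HB.instance Definition _ := Choice.on umod.

Definition umod_gen (x : X) : umod := \pi_{eq_quot comb_eqv} [:: (1, x)].

Definition umod_lift (U : lmodType k) (phi : X -> U) (t : umod) : U :=
  comb_eval phi (repr (t : {eq_quot comb_eqv})).

Lemma lift_pi (U : lmodType k) (phi : X -> U) t : P phi ->
  umod_lift phi (\pi_{eq_quot comb_eqv} t) = comb_eval phi t.
Proof.
move=> Pphi; rewrite /umod_lift; case: piP => t' /eqmodP /asboolP h.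
by rewrite h.
Qed.

Lemma umodP (x y : umod) :
  (forall (U : lmodType k) (phi : X -> U), P phi ->
     umod_lift phi x = umod_lift phi y) ->
  x = y.
Proof.
move=> h; rewrite -[x]reprK -[y]reprK; apply/eqmodP/asboolP => U phi Pphi.
exact: h.
Qed.

Definition umod_add (x y : umod) : umod :=
  \pi_{eq_quot comb_eqv} (repr (x : {eq_quot comb_eqv}) ++
                          repr (y : {eq_quot comb_eqv})).
Definition umod_scale (c : k) (x : umod) : umod :=
  \pi_{eq_quot comb_eqv}
    [seq (c * p.1, p.2) | p <- repr (x : {eq_quot comb_eqv})].
Definition umod_zero : umod := \pi_{eq_quot comb_eqv} [::].

Let liftD (U : lmodType k) (phi : X -> U) x y : P phi ->
  umod_lift phi (umod_add x y) = umod_lift phi x + umod_lift phi y.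
Proof. by move=> Pphi; rewrite lift_pi // /comb_eval big_cat. Qed.

Let liftZ (U : lmodType k) (phi : X -> U) c x : P phi ->
  umod_lift phi (umod_scale c x) = c *: umod_lift phi x.
Proof.
move=> Pphi; rewrite lift_pi // /umod_lift /comb_eval big_map scaler_sumr.
by apply: eq_bigr => p _; rewrite scalerA.
Qed.

Let lift0 (U : lmodType k) (phi : X -> U) :
  P phi -> umod_lift phi umod_zero = 0.
Proof. by move=> Pphi; rewrite lift_pi // /comb_eval big_nil. Qed.

Let addA : associative umod_add.
Proof. by move=> x y z; apply: umodP => U phi h; rewrite !liftD // addrA. Qed.
Let addC : commutative umod_add.
Proof. by move=> x y; apply: umodP => U phi h; rewrite !liftD // addrC. Qed.
Let add0 : left_id umod_zero umod_add.
Proof.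
by move=> x; apply: umodP => U phi h; rewrite liftD // lift0 // add0r.
Qed.
Let addN : left_inverse umod_zero (umod_scale (-1)) umod_add.
Proof.
move=> x; apply: umodP => U phi h.
by rewrite liftD // liftZ // lift0 // scaleN1r addNr.
Qed.

HB.instance Definition _ := GRing.isZmodule.Build umod addA addC add0 addN.

Let scaleA a b v : umod_scale a (umod_scale b v) = umod_scale (a * b) v.
Proof. by apply: umodP => U phi h; rewrite !liftZ // scalerA. Qed.
Let scale1 : left_id 1 umod_scale.
Proof. by move=> x; apply: umodP => U phi h; rewrite !liftZ // scale1r. Qed.
Let scaleDr : right_distributive umod_scale +%R.
Proof.
by move=> a x y; apply: umodP => U phi h; rewrite ?(liftZ, liftD) // scalerDr.
Qed.
Let scaleDl v : {morph umod_scale^~ v : a b / a + b}.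
Proof.
by move=> a b; apply: umodP => U phi h; rewrite ?(liftZ, liftD) // scalerDl.
Qed.

HB.instance Definition _ :=
  GRing.Zmodule_isLmodule.Build k umod scaleA scale1 scaleDr scaleDl.

Lemma lift_linear (U : lmodType k) (phi : X -> U) :
  P phi -> linear (umod_lift phi).
Proof.
move=> h a x y.
by rewrite -(liftZ a x h) -(liftD (umod_scale a x) y h).
Qed.

Lemma lift_gen (U : lmodType k) (phi : X -> U) x : P phi ->
  umod_lift phi (umod_gen x) = phi x.
Proof. by move=> h; rewrite lift_pi // /comb_eval big_seq1 scale1r. Qed.

End UniversalModule.

Section Tensors.
Variable k : fieldType.

Definition bilinear_map (V W : lmodType k) (U : lmodType k)
    (phi : V * W -> U) : Prop :=
  (forall c x x' y, phi (c *: x + x', y) = c *: phi (x, y) + phi (x', y)) /\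
  (forall c x y y', phi (x, c *: y + y') = c *: phi (x, y) + phi (x, y')).

Definition tens (V W : lmodType k) := umod (@bilinear_map V W).
HB.instance Definition _ V W := GRing.Lmodule.on (tens V W).

Definition tlift (V W U : lmodType k) (phi : V -> W -> U) : tens V W -> U :=
  umod_lift (fun xy => phi xy.1 xy.2).

(* A sequence of vectors stands for the pure tensor of its entries; a map on
   sequences is multilinear when it is linear in each entry. *)
Definition multilinear (V U : lmodType k) (phi : seq V -> U) : Prop :=
  forall (u v : seq V) c x y,
    phi (u ++ (c *: x + y) :: v) = c *: phi (u ++ x :: v) + phi (u ++ y :: v).

Definition tensalg (V : lmodType k) := umod (@multilinear V).
HB.instance Definition _ V := GRing.Lmodule.on (tensalg V).

Section TensorAlgebra.
Variable V : lmodType k.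
Local Notation T := (tensalg V).

Definition pure (w : seq V) : T := umod_gen (@multilinear V) w.

Definition tlin (U : lmodType k) (phi : seq V -> U) : T -> U := umod_lift phi.

Lemma pure_multilinear : multilinear pure.
Proof.
move=> u v c x y; apply: umodP => U phi h.
have := lift_linear h c (pure (u ++ x :: v)) (pure (u ++ y :: v)).
by rewrite /pure !lift_gen // => ->; apply: h.
Qed.

Definition tmul (t t' : T) : T :=
  tlin (fun w => tlin (fun w' => pure (w ++ w')) t') t.

Let cat_ml w : multilinear (fun w' => pure (w ++ w')).
Proof. by move=> u v c x y; rewrite !catA pure_multilinear. Qed.

Let tlin_ml t' : multilinear (fun w => tlin (fun w' => pure (w ++ w')) t').
Proof.
move=> u v c x y; rewrite /tlin /umod_lift /comb_eval.
rewrite scaler_sumr -big_split /=; apply: eq_bigr => p _.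
rewrite -!catA !cat_cons pure_multilinear scalerDr !scalerA mulrC.
by [].
Qed.

Let tmul_lin_l t' : linear (tmul^~ t').
Proof. exact: lift_linear (tlin_ml t'). Qed.

Let tmul_lin_r t : linear (tmul t).
Proof.
move=> c x y.
have tmulE z : tmul t z = \sum_(p <- repr (t : {eq_quot _}))
    p.1 *: tlin (fun w' => pure (p.2 ++ w')) z by [].
rewrite !tmulE scaler_sumr -big_split /=; apply: eq_bigr => p _.
by rewrite /tlin (lift_linear (cat_ml p.2)) scalerDr !scalerA mulrC.
Qed.

Lemma tmul_pure w w' : tmul (pure w) (pure w') = pure (w ++ w').
Proof.
rewrite /tmul /pure /tlin lift_gen; last exact: tlin_ml.
by rewrite lift_gen.
Qed.

Lemma tensalg_ind (Q : T -> Prop) :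
  Q 0 -> (forall c w t, Q t -> Q (c *: pure w + t)) -> forall t, Q t.
Proof.
move=> Q0 QS t.
suff -> : t = \sum_(p <- repr (t : {eq_quot _})) p.1 *: pure p.2.
  by elim: (repr _) => [|p s IH]; rewrite (big_nil, big_cons) //; apply: QS.
apply: umodP => U phi h.
rewrite -[LHS]/(comb_eval phi (repr (t : {eq_quot _}))) /comb_eval.
elim: (repr _) => [|p s IH]; rewrite !(big_nil, big_cons).
  have := lift_linear h (-1) (0 : T) 0.
  by rewrite scaleN1r oppr0 addr0 scaleN1r addNr => ->.
by rewrite IH (lift_linear h) lift_gen.
Qed.

Let lin0 (f : T -> T) : linear f -> f 0 = 0.
Proof.
by move=> h; have := h (-1) 0 0; rewrite !scaleN1r oppr0 addr0 addNr.
Qed.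

Let mulA : associative tmul.
Proof.
move=> x y z.
have l0 t := lin0 (tmul_lin_l t); have r0 t := lin0 (tmul_lin_r t).
elim/tensalg_ind: x => [|a u x IHx]; first by rewrite !l0.
rewrite !(tmul_lin_l _ a) IHx; congr (_ *: _ + _) => {x IHx}.
elim/tensalg_ind: y => [|b v y IHy]; first by rewrite !(r0, l0).
rewrite !(tmul_lin_l _ b, tmul_lin_r _ b) IHy; congr (_ *: _ + _) => {y IHy}.
elim/tensalg_ind: z => [|c w z IHz]; first by rewrite !(r0, l0).
by rewrite !(tmul_lin_l _ c, tmul_lin_r _ c) IHz !tmul_pure catA.
Qed.

Let mul1x : left_id (pure [::]) tmul.
Proof.
elim/tensalg_ind => [|a u x IHx]; first by rewrite (lin0 (tmul_lin_r _)).
by rewrite (tmul_lin_r _ a) IHx tmul_pure.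
Qed.

Let mulx1 : right_id (pure [::]) tmul.
Proof.
elim/tensalg_ind => [|a u x IHx]; first by rewrite (lin0 (tmul_lin_l _)).
by rewrite (tmul_lin_l _ a) IHx tmul_pure cats0.
Qed.

Let mulDl : left_distributive tmul +%R.
Proof. by move=> x y z; have := tmul_lin_l z 1 x y; rewrite /= !scale1r. Qed.

Let mulDr : right_distributive tmul +%R.
Proof. by move=> x y z; have := tmul_lin_r x 1 y z; rewrite /= !scale1r. Qed.

Let one_neq0 : pure [::] != 0.
Proof.
have ml : multilinear (fun w : seq V => (nilp w)%:R : k^o).
  by move=> [|? ?] v c x y /=; rewrite scaler0 addr0.
apply/eqP => /(congr1 (umod_lift (fun w : seq V => (nilp w)%:R : k^o))).
rewrite lift_gen //=.
have := lift_linear ml (-1) (0 : T) 0.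
rewrite scaleN1r oppr0 addr0 scaleN1r addNr => -> /eqP.
by rewrite oner_eq0.
Qed.

HB.instance Definition _ :=
  GRing.Zmodule_isNzRing.Build T mulA mul1x mulx1 mulDl mulDr one_neq0.

Let scaleAl (c : k) (x y : T) : c *: (x * y) = (c *: x) * y.
Proof.
by have := tmul_lin_l y c x 0; rewrite /= (lin0 (tmul_lin_l _)) !addr0 => <-.
Qed.
HB.instance Definition _ := GRing.Lmodule_isLalgebra.Build k T scaleAl.

Let scaleAr (c : k) (x y : T) : c *: (x * y) = x * (c *: y).
Proof.
by have := tmul_lin_r x c y 0; rewrite /= (lin0 (tmul_lin_r _)) !addr0 => <-.
Qed.
HB.instance Definition _ := GRing.Lalgebra_isAlgebra.Build k T scaleAr.

Definition tpow (n : nat) : set T :=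
  lspan [set t | exists w, size w = n /\ t = pure w].

Definition ideal (S : set T) : set T :=
  lspan [set t | exists u s v, S s /\ t = u * s * v].

End TensorAlgebra.

End Tensors.

Record cgAlg (k : fieldType) := CGAlg {
  cg_alg :> algType k;
  gr : nat -> submodClosed cg_alg;
  gr_sum : forall a : cg_alg, exists (n : nat) (x : nat -> cg_alg),
    (forall i, x i \in gr i) /\ a = \sum_(i < n) x i;
  gr_free : forall (n : nat) (x : nat -> cg_alg),
    (forall i, x i \in gr i) -> \sum_(i < n) x i = 0 ->
    forall i, (i < n)%N -> x i = 0;
  gr_mul : forall i j (a b : cg_alg),
    a \in gr i -> b \in gr j -> a * b \in gr (i + j);
  gr_conn : forall a : cg_alg, a \in gr 0 <-> exists c : k, a = c%:A
}.

Section ConnectedGraded.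
Variables (k : fieldType) (A : cgAlg k).

Definition piece (i : nat) : Type := {a : A | a \in gr A i}.
HB.instance Definition _ i := SubType.on (piece i).
HB.instance Definition _ i := Choice.on (piece i).
HB.instance Definition _ i := [SubChoice_isSubLmodule of piece i by <:].

Definition aug : {pred A} :=
  fun a => `[< lspan [set b : A | exists i, (0 < i)%N /\ b \in gr A i] a >].

Lemma aug_submod : subsemimod_closed aug.
Proof.
split; first split.
- by apply/asboolP/span0.
- move=> x y /asboolP hx /asboolP hy; apply/asboolP.
  by rewrite -[x]scale1r; apply: spanP.
- move=> c x /asboolP hx; apply/asboolP.
  by rewrite -[_ *: _]addr0; apply: spanP => //; apply: span0.
Qed.
HB.instance Definition _ := GRing.isSubmodClosed.Build k A aug aug_submod.

Lemma augM (a b : A) : a \in aug -> b \in aug -> a * b \in aug.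
Proof.
move=> /asboolP[t [ht ->]] /asboolP[t' [ht' ->]].
rewrite mulr_suml big_seq; apply: rpred_sum => p /ht [i [i0 hi]].
rewrite mulr_sumr big_seq; apply: rpred_sum => q /ht' [j [j0 hj]].
rewrite -scalerAl -scalerAr; do 2 apply: rpredZ.
apply/asboolP/span_base; exists (i + j)%N; split; first by rewrite addn_gt0 i0.
exact: gr_mul.
Qed.

Definition augm : Type := {a : A | a \in aug}.
HB.instance Definition _ := SubType.on augm.
HB.instance Definition _ := Choice.on augm.
HB.instance Definition _ := [SubChoice_isSubLmodule of augm by <:].

Definition augmul (x y : augm) : augm :=
  exist _ (val x * val y) (augM (valP x) (valP y)).

(* For i > 0 this is the inclusion of A_i into the augmentation ideal. *)
Definition inm (i : nat) (a : piece i) : augm := insubd 0 (val a).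

End ConnectedGraded.

Section Relations.
Variables (k : fieldType) (A : cgAlg k).
Local Notation A1 := (piece A 1).
Local Notation TA1 := (tensalg A1).

Definition tprod : TA1 -> A := tlin (fun w => \prod_(a <- w) val a).

Definition generated_in_degree1 : Prop := forall a : A, exists t, a = tprod t.

Definition mult1 (j : nat) : tens A1 (piece A j) -> A :=
  tlift (fun a b => val a * val b).

Variable xi : forall s, {linear piece A s -> tens A1 (piece A s.-1)}.

Definition splits_mult : Prop :=
  forall s, (2 <= s)%N -> forall a, mult1 (xi s a) = val a.

Definition id_tens (j : nat) (phi : piece A j -> TA1) :
    tens A1 (piece A j) -> TA1 :=
  tlift (fun a b => pure [:: a] * phi b).

(* The value at s = 0 is never used. *)
Fixpoint theta (s : nat) : piece A s -> TA1 :=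
  match s with
  | 0 => fun=> 0
  | s'.+1 =>
      match s' return (piece A s' -> TA1) -> piece A s'.+1 -> TA1 with
      | 0 => fun _ a => pure [:: a]
      | _ => fun th a => id_tens th (xi _ a)
      end (@theta s')
  end.

(* The embedding of A_1 (x) A_(n-1) into the n-th tensor power of A_1. *)
Definition rel_incl (n : nat) : tens A1 (piece A n.-1) -> TA1 :=
  id_tens (@theta n.-1).

Definition graded_subspace (S : nat -> set TA1) : Prop :=
  forall n, subspace (S n) /\ S n `<=` @tpow _ A1 n.

Definition generates_relations (S : nat -> set TA1) : Prop :=
  ideal (\bigcup_n S n) = [set t | tprod t = 0].

Definition minimal_relations (S : nat -> set TA1) : Prop :=
  [/\ graded_subspace S, generates_relations S &
      forall S', graded_subspace S' -> (forall n, S' n `<=` S n) ->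
        generates_relations S' -> S' = S].

(* R n is the space R_n as a subspace of A_1 (x) A_(n-1); the relations proper are
   its image in the n-th tensor power of A_1. *)
Definition relation_space (R : forall n, set (tens A1 (piece A n.-1))) : Prop :=
  [/\ forall n, subspace (R n),
      forall n, (n < 2)%N -> R n = [set 0] &
      minimal_relations (fun n => @rel_incl n @` R n)].

End Relations.

Arguments rel_incl {k A} xi {n}.
Arguments relation_space {k A} xi R.

Section Bar.
Variables (k : fieldType) (A : cgAlg k).

Definition bar := tensalg (augm A).
HB.instance Definition _ := GRing.Lmodule.on bar.

Definition bar_hom (n s : nat) : set bar :=
  lspan [set t | exists w ds, [/\ size w = n, sumn ds = s,
    all2 (fun d (a : augm A) => val a \in gr A d) ds w & t = pure w]].

Definition contract (w : seq (augm A)) (i : nat) : seq (augm A) :=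
  take i.-1 w ++ augmul (nth 0 w i.-1) (nth 0 w i) :: drop i.+1 w.

(* Entries of w are numbered from 0, so that contract w i multiplies the i-th
   and (i+1)-st entries in the usual numbering. *)
Definition bar_d : bar -> bar :=
  tlin (fun w => \sum_(1 <= i < size w) (-1) ^+ i *: pure (contract w i)).

Definition cochain := bar -> k^o.
HB.instance Definition _ := GRing.Lmodule.on cochain.

(* Degree n, Adams degree -s. *)
Definition coch (n s : nat) : set cochain :=
  [set f | linear f /\
     forall n' s' t, (n', s') != (n, s) -> bar_hom n' s' t -> f t = 0].

(* f |-> (-1)^(deg f) f *)
Definition cinv (f : cochain) : cochain :=
  tlin (fun w => (-1) ^+ size w *: f (pure w)).

Definition codiff (f : cochain) : cochain := fun t => - cinv f (bar_d t).

(* (fg)(x (x) y) = (-1)^(|g||x|) f(x) g(y) on the deconcatenations of w.  The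
   Koszul sign is forced by the Leibniz rule for codiff. *)
Definition cmul (f g : cochain) : cochain :=
  tlin (fun w => \sum_(i < (size w).+1)
    (-1) ^+ (i * (size w - i)) *
      f (pure (take i w)) * g (pure (drop i w)) : k^o).

Definition cobound (n s : nat) : set cochain :=
  if n is n'.+1 then codiff @` coch n' s else [set 0].

Definition cocycle (n s : nat) : set cochain :=
  [set f | coch n s f /\ codiff f = 0].

Definition to_bar (j : nat) : tens (piece A 1) (piece A j) -> bar :=
  tlift (fun a b => pure [:: inm a; inm b]).

End Bar.

Arguments bar {k} A.
Arguments cochain {k} A.
Arguments bar_hom {k A} n s.
Arguments bar_d {k A} _.
Arguments coch {k A} n s.
Arguments cinv {k A} f.
Arguments codiff {k A} f.
Arguments cobound {k A} n s.
Arguments cocycle {k A} n s.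
Arguments to_bar {k A j} _.

(* The choices and the resulting operators of Merkulov's construction for the
   dual of the bar construction; its cohomology E is the sum of the mH n s.
   mH n s and mL n s are the components of Adams degree -s of H^n and L^n; mpr
   and mG only matter on sums of homogeneous cochains, where they are determined
   by the other fields. *)
Record merkulov (k : fieldType) (A : cgAlg k) := Merkulov {
  mH : nat -> nat -> set (cochain A);
  mL : nat -> nat -> set (cochain A);
  mpr : {linear cochain A -> cochain A};
  mG : {linear cochain A -> cochain A};
  mH_sub : forall n s, subspace (mH n s);
  mL_sub : forall n s, subspace (mL n s);
  mZ_split : forall n s, is_dsum (cocycle n s) (cobound n s) (mH n s);
  mT_split : forall n s, is_dsum (coch n s) (cocycle n s) (mL n s);
  mpr_H : forall n s x, mH n s x -> mpr x = x;
  mpr_B : forall n s x, cobound n s x -> mpr x = 0;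
  mpr_L : forall n s x, mL n s x -> mpr x = 0;
  mG_H : forall n s x, mH n s x -> mG x = 0;
  mG_L : forall n s x, mL n s x -> mG x = 0;
  mG_B : forall n s x, mL n s x -> mG (codiff x) = x
}.

Section Model.
Variables (k : fieldType) (A : cgAlg k) (M : merkulov A).
Local Notation C := (cochain A).

(* lambda_rec b x is lambda_n(x_1, ..., x_n) for n = size x >= 2, as soon as the
   recursion bound b is at least n; glambda is G lambda_s, with the convention
   G lambda_1 = - id.  In the term (s, t), with t = n - s, moving G lambda_t, of
   degree 1 - t, past x_1, ..., x_s produces the Koszul sign
   (-1)^((1-t)(|x_1| + ... + |x_s|)), which is the effect of applying
   iter t.-1 cinv to each of x_1, ..., x_s. *)
Fixpoint lambda_rec (b : nat) (x : seq C) : C :=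
  if b is b'.+1 then
    let glambda (y : seq C) : C :=
      if size y == 1%N then - head 0 y else mG M (lambda_rec b' y) in
    if size x == 2 then cmul (nth 0 x 0) (nth 0 x 1)
    else \sum_(1 <= s < size x) (-1) ^+ s.+1 *:
      cmul (glambda [seq iter (size x - s).-1 cinv y | y <- take s x])
           (glambda (drop s x))
  else 0.

Definition lambda (x : seq C) : C := lambda_rec (size x) x.

(* m_n(x_1, ..., x_n) for n = size x and x_i in the sum of the mH p s. *)
Definition mop (x : seq C) : C := if size x == 1%N then 0 else mpr M (lambda x).

Variable xi : forall s, {linear piece A s -> tens (piece A 1) (piece A s.-1)}.
Variable R : forall n, set (tens (piece A 1) (piece A n.-1)).

Definition vanishes_on (f : C) (U : set (bar A)) : Prop :=
  forall t, U t -> f t = 0.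

(* In degree 1, E^1 = mH 1 1 is the dual of A_1.  In degree 2, mH 2 s is the dual
   of R_s, and mL 2 s that of im(d^(-3)_s), through the
   decomposition of the degree -2, Adams degree s part of the bar construction
   as im(d^(-3)_s) (+) R_s (+) xi_s(A_s). *)
Definition adapted : Prop :=
  [/\ mH M 1 1 = coch 1 1 /\ mL M 1 1 = [set 0],
      forall s, (2 <= s)%N -> mH M 1 s = [set 0] /\ mL M 1 s = coch 1 s,
      forall s, (2 <= s)%N ->
        mH M 2 s = [set f | [/\ coch 2 s f,
          vanishes_on f (bar_d @` bar_hom 3 s) &
          vanishes_on f (range (fun a => to_bar (@xi s a)))]] &
      forall s, (2 <= s)%N ->
        mL M 2 s = [set f | [/\ coch 2 s f,
          vanishes_on f (to_bar @` @R s) &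
          vanishes_on f (range (fun a => to_bar (@xi s a)))]]].

End Model.

Section Dual.
Variable k : fieldType.

(* The functional phi_1 (x) ... (x) phi_n on V^(x)n, where the phi_i have degree
   1 and V has degree -1: moving each phi_j past the v_i with i < j gives
   (-1)^(n(n-1)/2). *)
Definition koszul_tensor (V : lmodType k) (n : nat) (phi : n.-tuple (V -> k)) :
    tensalg V -> k :=
  tlin (fun w => (if size w == n then
    (-1) ^+ 'C(n, 2) * \prod_(i < n) tnth phi i (nth 0 w i) else 0) : k^o).

Variable A : cgAlg k.

(* Identifies a cochain of degree 1 and Adams degree -1 with a linear form on
   A_1. *)
Definition form1 (f : cochain A) : piece A 1 -> k :=
  fun a => f (pure [:: inm a]).

End Dual.

(* Main.v *)
Require Import Defs.
From mathcomp Require Import all_boot all_order all_algebra.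
From mathcomp Require Import boolp classical_sets functions.
From mathcomp Require Import generic_quotient zify.

(** Write C for the dual of the bar construction.  Two facts drive the proof.

    The first concerns G in degree 2.  In degree 1 there is no homology of
    Adams degree s >= 2, so G sends a cochain u of C^2_(-s) to the g in C^1_(-s)
    whose coboundary is the B-component of u.  The H- and L-components of u
    vanish on xi_s(A_s), the differential of the bar construction sends [a|b]
    to -[ab], and xi_s splits the multiplication, so G u = - u o xi_s on A_s
    (mG_coch).

    The second is that all the terms of lambda_n but one vanish on
    A_1 (x) A_(n-1).  For f_1, ..., f_n of bidegree (1, -1), the term (s, t) is
    the product of a cochain on A_s with a cochain on A_t, so that only s = 1
    survives.  Up to sign, lambda_n(f_1, ..., f_n)(a (x) b) is therefore
    f_1(a) times G lambda_(n-1)(f_2, ..., f_n)(b), that is f_1(a) times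
    lambda_(n-1)(f_2, ..., f_n)(xi b).  As theta is built by the same iteration
    of xi, induction on n identifies lambda_n(f_1, ..., f_n) on
    A_1 (x) A_(n-1) with f_1 (x) ... (x) f_n along the embedding of
    A_1 (x) A_(n-1) into the n-th tensor power of A_1 (lambda_value).  For the
    signs, passing from n-1 to n >= 3 costs a factor
      (-1)^(n-2) . (-1) . (-1) . (-1) = (-1)^(n-1);
    the four factors are the Koszul sign on f_1, the convention
    G lambda_1 = - id, the sign in the product of two cochains of degree 1, and
    the sign in G u = - u o xi.  At n = 2 the product alone gives -1.
    Altogether this is (-1)^(n(n-1)/2), the Koszul sign of
    f_1 (x) ... (x) f_n.

    Finally m_n(f_1, ..., f_n) is the H-component of lambda_n(f_1, ..., f_n).
    The two have the same restriction to R_n: the L-component vanishes on R_n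
    by the choice of L, and so does a coboundary, because relations multiply to
    0 in A (multp_relation). *)

Set Implicit Arguments.
Unset Strict Implicit.
Import GRing.Theory.
Local Open Scope ring_scope.
Local Open Scope quotient_scope.

(** * Linear and multilinear maps on universal modules *)

Lemma regE (k : fieldType) (c : k) (x : k^o) : c *: x = c * x.
Proof. by []. Qed.

Section Linear.
Variables (k : fieldType) (V U : lmodType k) (f : V -> U).
Hypothesis lf : linear f.

Lemma linD x y : f (x + y) = f x + f y.
Proof. by have := lf 1 x y; rewrite !scale1r. Qed.

Lemma lin0 : f 0 = 0.
Proof. by apply: (addIr (f 0)); rewrite -linD !add0r. Qed.

Lemma linZ c x : f (c *: x) = c *: f x.
Proof. by have := lf c x 0; rewrite !addr0 lin0 addr0. Qed.

Lemma linN x : f (- x) = - f x.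
Proof. by rewrite -scaleN1r linZ scaleN1r. Qed.

Lemma linear_lspan0 (S : set V) : (forall x, S x -> f x = 0) ->
  forall x, lspan S x -> f x = 0.
Proof.
move=> fS _ [t [tS ->]]; elim: t tS => [|p t IH] tS.
  by rewrite big_nil lin0.
rewrite big_cons linD linZ fS ?IH ?scaler0 ?addr0 //.
- by move=> q qt; apply: tS; rewrite inE qt orbT.
- by apply: tS; rewrite mem_head.
Qed.

End Linear.

Section UniversalModule.
Variables (k : fieldType) (X : choiceType).
Variable P : forall U : lmodType k, (X -> U) -> Prop.

(** The generators span, by the universal property. *)
Lemma umod_ext (U : lmodType k) (f g : umod P -> U) :
  linear f -> linear g ->
  (forall x, f (umod_gen P x) = g (umod_gen P x)) -> f =1 g.
Proof.
move=> lf lg fg t.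
have -> : t = \sum_(p <- repr (t : {eq_quot comb_eqv P})) p.1 *: umod_gen P p.2.
  apply: umodP => W phi h.
  rewrite -[LHS]/(comb_eval phi (repr (t : {eq_quot comb_eqv P}))) /comb_eval.
  elim: (repr _) => [|p s IH]; rewrite !(big_nil, big_cons).
    by rewrite (lin0 (lift_linear h)).
  by rewrite IH (lift_linear h) lift_gen.
elim: (repr _) => [|p s IH]; rewrite !(big_nil, big_cons).
  by rewrite (lin0 lf) (lin0 lg).
by rewrite lf lg IH fg.
Qed.

End UniversalModule.

Section Tensors.
Variable k : fieldType.

Definition tgen (V W : lmodType k) (x : V) (y : W) : tens V W :=
  umod_gen (@bilinear_map k V W) (x, y).

Lemma tens_ext (V W U : lmodType k) (f g : tens V W -> U) :
  linear f -> linear g ->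
  (forall x y, f (tgen x y) = g (tgen x y)) -> f =1 g.
Proof. by move=> lf lg fg; apply: umod_ext => // -[x y]; apply: fg. Qed.

Definition bilin (V W U : lmodType k) (phi : V -> W -> U) : Prop :=
  (forall c x x' y, phi (c *: x + x') y = c *: phi x y + phi x' y) /\
  (forall c x y y', phi x (c *: y + y') = c *: phi x y + phi x y').

Lemma tlift_linear (V W U : lmodType k) (phi : V -> W -> U) :
  bilin phi -> linear (tlift phi).
Proof. by move=> [h1 h2]; apply: lift_linear. Qed.

Lemma tlift_gen (V W U : lmodType k) (phi : V -> W -> U) x y :
  bilin phi -> tlift phi (tgen x y) = phi x y.
Proof. by move=> [h1 h2]; rewrite /tlift lift_gen. Qed.

Lemma tensalg_ext (V U : lmodType k) (f g : tensalg V -> U) :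
  linear f -> linear g -> (forall w, f (pure w) = g (pure w)) -> f =1 g.
Proof. by move=> lf lg fg; apply: umod_ext. Qed.

Lemma tlin_pure (V U : lmodType k) (phi : seq V -> U) w :
  multilinear phi -> tlin phi (pure w) = phi w.
Proof. by move=> h; rewrite /tlin /pure lift_gen. Qed.

Lemma tlin_linear (V U : lmodType k) (phi : seq V -> U) :
  multilinear phi -> linear (tlin phi).
Proof. exact: lift_linear. Qed.

Lemma pure_mul (V : lmodType k) (w w' : seq V) :
  pure w * pure w' = pure (w ++ w').
Proof. exact: tmul_pure. Qed.

Lemma pure1_linear (V U : lmodType k) (h : U -> V) :
  linear h -> linear (fun x => pure [:: h x]).
Proof. by move=> lh c x y; rewrite lh (pure_multilinear [::] [::]). Qed.

Lemma pure_mul_bilin (V W : lmodType k) (phi : W -> tensalg V) :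
  linear phi -> bilin (fun a b => pure [:: a] * phi b).
Proof.
move=> lphi; split=> c x y z.
  by rewrite (pure_multilinear [::] [::]) mulrDl scalerAl.
by rewrite lphi mulrDr scalerAr.
Qed.

End Tensors.

(** * The Koszul tensor product of linear forms *)

Section KoszulTensor.
Variables (k : fieldType) (V : lmodType k).

Lemma koszul_multilinear n (phi : n.-tuple (V -> k)) :
  (forall i, linear (tnth phi i : V -> k^o)) ->
  multilinear (fun w => (if size w == n then
    (-1) ^+ 'C(n, 2) * \prod_(i < n) tnth phi i (nth 0 w i) else 0) : k^o).
Proof.
move=> lphi u v c x y; rewrite !size_cat /=.
case: eqP => [sz|_]; last by rewrite scaler0 addr0.
have ltu : (size u < n)%N by rewrite -sz; lia.
pose j := Ordinal ltu.
have nj z : nth 0 (u ++ z :: v) j = z by rewrite nth_cat ltnn subnn.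
have ni z (i : 'I_n) : i != j ->
    nth 0 (u ++ z :: v) i = nth 0 (u ++ 0 :: v) i.
  move=> ij; have {}ij : (nat_of_ord i <> size u) by move/eqP: ij => H E; apply: H; apply: val_inj.
  rewrite !nth_cat; case: ltnP => // lui.
  have : (0 < i - size u)%N by rewrite subn_gt0 ltn_neqAle lui andbT; apply/eqP => /esym.
  by case: (i - size u)%N.
have pj z : \prod_(i < n) tnth phi i (nth 0 (u ++ z :: v) i) =
    tnth phi j z * \prod_(i < n | i != j) tnth phi i (nth 0 (u ++ 0 :: v) i).
  rewrite (bigD1 j) //= nj; congr (_ * _).
  by apply: eq_bigr => i /ni ->.
rewrite !pj (lphi j) mulrDl mulrDr; congr (_ + _).
by rewrite !regE -mulrA mulrCA.
Qed.

Lemma koszul_linear n (phi : n.-tuple (V -> k)) :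
  (forall i, linear (tnth phi i : V -> k^o)) ->
  linear (koszul_tensor phi : _ -> k^o).
Proof. by move=> lphi; apply/tlin_linear/koszul_multilinear. Qed.

Lemma koszul_pure n (phi : n.-tuple (V -> k)) w :
  (forall i, linear (tnth phi i : V -> k^o)) -> size w = n ->
  koszul_tensor phi (pure w) =
    (-1) ^+ 'C(n, 2) * \prod_(i < n) tnth phi i (nth 0 w i).
Proof.
move=> lphi sz; rewrite /koszul_tensor tlin_pure ?sz ?eqxx //.
exact: koszul_multilinear.
Qed.

(** Moving the last n forms past a vector of degree -1 gives the sign. *)
Lemma koszul_cons n (phi : n.+1.-tuple (V -> k)) a t :
  (forall i, linear (tnth phi i : V -> k^o)) ->
  koszul_tensor phi (pure [:: a] * t) =
    (-1) ^+ n * thead phi a * koszul_tensor (behead_tuple phi) t.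
Proof.
move=> lphi.
have tb (i : 'I_n) : tnth (behead_tuple phi) i = tnth phi (lift ord0 i).
  by rewrite tnth_behead; congr tnth; apply: val_inj; rewrite /= inordK // ltnS.
have lb i : linear (tnth (behead_tuple phi) i : V -> k^o) by rewrite tb.
move: t.
apply: (@tensalg_ext k V k^o (fun t => koszul_tensor phi (pure [:: a] * t))
   (fun t => (-1) ^+ n * thead phi a * koszul_tensor (behead_tuple phi) t)).
- move=> c x y /=; rewrite mulrDr -scalerAr; exact: (koszul_linear lphi).
- move=> c x y /=; rewrite (koszul_linear lb) mulrDr; congr (_ + _).
  by rewrite !regE mulrCA.
move=> w; rewrite pure_mul /koszul_tensor !tlin_pure //;
  try exact: koszul_multilinear.
rewrite /= eqSS; case: eqP => _; last by rewrite mulr0.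
rewrite big_ord_recl /= binS bin1 addnC exprD.
rewrite (eq_bigr (fun i => tnth (behead_tuple phi) i (nth 0 w i))); last first.
  by move=> i _; rewrite tb.
by rewrite -!mulrA; congr (_ * _); rewrite mulrCA.
Qed.

End KoszulTensor.

(** * Multiplication on the homogeneous pieces *)

Section Pieces.
Variables (k : fieldType) (A : cgAlg k).

Lemma inm_val i (a : piece A i.+1) : val (inm a) = val a.
Proof.
rewrite insubdK //; apply/asboolP/span_base; exists i.+1; split=> //.
exact: (valP a).
Qed.

Lemma val_piece_linear i : linear (val : piece A i -> A).
Proof. exact: linearP. Qed.

Lemma val_augm_linear : linear (val : augm A -> A).
Proof. exact: linearP. Qed.

Lemma inm_linear i : linear (@inm k A i.+1).
Proof.
move=> c x y; apply: val_inj.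
by rewrite val_augm_linear !inm_val val_piece_linear.
Qed.

Definition mulp j (a : piece A 1) (b : piece A j) : piece A j.+1 :=
  exist _ (val a * val b) (gr_mul (valP a) (valP b)).

Lemma val_mulp j (a : piece A 1) (b : piece A j) :
  val (mulp a b) = val a * val b.
Proof. by []. Qed.

Lemma mulp_bilin j : bilin (@mulp j).
Proof.
split=> c x y z; apply: val_inj; rewrite val_piece_linear !val_mulp val_piece_linear.
  by rewrite mulrDl scalerAl.
by rewrite mulrDr scalerAr.
Qed.

(** The multiplication mult1, with values in the piece instead of the whole
    algebra: the cochains of degree 1 are evaluated on the pieces. *)
Definition multp j : tens (piece A 1) (piece A j) -> piece A j.+1 :=
  tlift (@mulp j).

Lemma multp_linear j : linear (@multp j).
Proof. exact/tlift_linear/mulp_bilin. Qed.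

Lemma mult1_bilin j : bilin (fun (a : piece A 1) (b : piece A j) => val a * val b).
Proof.
split=> c x y z; rewrite val_piece_linear; first by rewrite mulrDl scalerAl.
by rewrite mulrDr scalerAr.
Qed.

Lemma val_multp j t : val (@multp j t) = mult1 t.
Proof.
move: t; apply: (@tens_ext _ _ _ _ (fun t => val (multp t)) (@mult1 k A j)).
- by move=> c x y /=; rewrite multp_linear val_piece_linear.
- exact/tlift_linear/mult1_bilin.
move=> a b; rewrite /multp /mult1 !tlift_gen //; [exact: mult1_bilin|exact: mulp_bilin].
Qed.

Lemma tprod_multilinear : multilinear (fun w : seq (piece A 1) => \prod_(a <- w) val a).
Proof.
move=> u v c x y; rewrite !big_cat !big_cons val_piece_linear /=.
by rewrite mulrDl mulrDr -scalerAl -scalerAr.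
Qed.

Lemma tprod_mul a t : tprod (pure [:: a] * t) = val a * tprod (A := A) t.
Proof.
move: t; apply: (tensalg_ext (f := fun t => tprod (pure [:: a] * t))
   (g := fun t => val a * tprod (A := A) t)).
- move=> c x y /=; rewrite mulrDr -scalerAr.
  exact: (tlin_linear tprod_multilinear).
- move=> c x y /=; rewrite /tprod (tlin_linear tprod_multilinear).
  by rewrite mulrDr scalerAr.
move=> w; rewrite pure_mul /tprod !tlin_pure ?big_cons //;
  exact: tprod_multilinear.
Qed.

Variable xi : forall s, {linear piece A s -> tens (piece A 1) (piece A s.-1)}.
Hypothesis hxi : splits_mult xi.

Lemma theta_linear s : linear (theta xi (s := s)).
Proof.
elim: s => [|[|s] IH].
- by move=> c x y; rewrite /= scaler0 addr0.
- by move=> c x y; rewrite /= (pure_multilinear [::] [::]).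
move=> c x y; rewrite -/(theta xi) /=.
by rewrite linearP; apply/tlift_linear/pure_mul_bilin/IH.
Qed.

Lemma rel_incl_linear n : linear (rel_incl xi (n := n)).
Proof. exact/tlift_linear/pure_mul_bilin/theta_linear. Qed.

Lemma rel_incl_gen n a (b : piece A n.-1) :
  rel_incl xi (n := n) (tgen a b) = pure [:: a] * theta xi b.
Proof. by rewrite /rel_incl /id_tens tlift_gen //; apply/pure_mul_bilin/theta_linear. Qed.

Lemma thetaSS s (a : piece A s.+2) :
  theta xi a = rel_incl xi (n := s.+2) (xi s.+2 a).
Proof. by []. Qed.

Lemma tprod_theta s (b : piece A s.+1) : tprod (theta xi b) = val b.
Proof.
elim: s b => [|s IH] b.
  rewrite /tprod tlin_pure ?big_seq1 //; exact: tprod_multilinear.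
rewrite thetaSS -(hxi (s := s.+2) _ b) //.
move: (xi s.+2 b); apply: (@tens_ext _ _ _ _ (fun t => tprod (rel_incl xi (n:=s.+2) t))).
- move=> c x y /=; rewrite rel_incl_linear.
  exact: (tlin_linear tprod_multilinear).
- exact/tlift_linear/mult1_bilin.
move=> x y; rewrite rel_incl_gen tprod_mul IH /mult1 tlift_gen //.
exact: mult1_bilin.
Qed.

Lemma tprod_rel_incl n (t : tens (piece A 1) (piece A n.+1)) :
  tprod (rel_incl xi (n := n.+2) t) = mult1 t.
Proof.
move: t; apply: (@tens_ext _ _ _ _ (fun t => tprod (rel_incl xi (n:=n.+2) t))).
- move=> c x y /=; rewrite rel_incl_linear.
  exact: (tlin_linear tprod_multilinear).
- exact/tlift_linear/mult1_bilin.
move=> x y; rewrite rel_incl_gen tprod_mul tprod_theta /mult1 tlift_gen //.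
exact: mult1_bilin.
Qed.

(** The relations lie in the ideal that they generate, which is the kernel of
    the multiplication of the tensor algebra. *)
Lemma multp_relation R n (r : tens (piece A 1) (piece A n.+1)) :
  relation_space xi R -> R n.+2 r -> multp r = 0.
Proof.
move=> [_ _ [_ gen _]] Rr; apply: val_inj; rewrite val_multp -tprod_rel_incl.
have : ideal (\bigcup_n [set rel_incl xi r | r in R n])%classic (rel_incl xi (n:=n.+2) r).
  apply/span_base; exists 1, (rel_incl xi (n:=n.+2) r), 1.
  split; first by exists n.+2 => //; exists r.
  by rewrite mul1r mulr1.
by rewrite gen.
Qed.

End Pieces.

(** * The bar construction and its dual *)

Lemma all2_cat (S T : Type) (r : S -> T -> bool) s1 s2 t1 t2 :
  size s1 = size t1 ->
  all2 r (s1 ++ s2) (t1 ++ t2) = all2 r s1 t1 && all2 r s2 t2.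
Proof. by elim: s1 t1 => [|x s1 IH] [|y t1] //= [/IH ->]; rewrite andbA. Qed.

Section Bar.
Variables (k : fieldType) (A : cgAlg k).
Local Notation C := (cochain A).

Lemma augmul_bilin : bilin (@augmul k A).
Proof.
have vm x y : val (@augmul k A x y) = val x * val y by [].
split=> c x y z; apply: val_inj; rewrite val_augm_linear !vm val_augm_linear.
  by rewrite mulrDl scalerAl.
by rewrite mulrDr scalerAr.
Qed.

(** The varying entry lies after the contracted pair, is one of its two
    members, or lies before it. *)
Lemma contract_multilinear (u v : seq (augm A)) c x y i :
  (0 < i < size u + (size v).+1)%N ->
  pure (contract (u ++ (c *: x + y) :: v) i) =
  c *: pure (contract (u ++ x :: v) i) + pure (contract (u ++ y :: v) i).
Proof.
case: i => // i /= ilt; rewrite /contract /= !take_cat !nth_cat !drop_cat.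
have [iu|ui] := ltnP i (size u); last first.
  have -> : (i.+1 < size u)%N = false by lia.
  have -> : (i.+2 < size u)%N = false by lia.
  case: (posnP (i - size u)%N) => [i0|].
    have -> : (i.+1 - size u = 1)%N by lia.
    have -> : (i.+2 - size u = 2)%N by lia.
    by rewrite i0 /= cats0 augmul_bilin.1 pure_multilinear.
  move=> ip.
  have -> : (i.+1 - size u = (i - size u).+1)%N by lia.
  have -> : (i.+2 - size u = (i - size u).+2)%N by lia.
  case: (i - size u)%N ip => // m _ /=.
  by rewrite -!catA !cat_cons pure_multilinear.
have [iu1|ui1] := ltnP i.+1 (size u); last first.
  have -> : (i.+2 < size u)%N = false by lia.
  have -> : (i.+1 - size u = 0)%N by lia.
  have -> : (i.+2 - size u = 1)%N by lia.
  by rewrite /= augmul_bilin.2 pure_multilinear.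
have [iu2|ui2] := ltnP i.+2 (size u).
  have mid m z : take i u ++ m :: drop i.+2 u ++ z :: v =
    (take i u ++ m :: drop i.+2 u) ++ z :: v by rewrite -catA.
  by rewrite !mid; exact: pure_multilinear.
have -> : (i.+2 - size u = 0)%N by lia.
by rewrite /= -!(cat_rcons (augmul _ _)); exact: pure_multilinear.
Qed.

Lemma bar_d_multilinear : multilinear (fun w : seq (augm A) =>
  \sum_(1 <= i < size w) (-1) ^+ i *: pure (contract w i)).
Proof.
move=> u v c x y; rewrite !size_cat /= scaler_sumr -big_split /=.
rewrite big_nat [RHS]big_nat; apply: eq_bigr => i ilt.
rewrite contract_multilinear //.
by rewrite scalerDr !scalerA mulrC.
Qed.

Lemma bar_d_linear : linear (@bar_d k A).
Proof. exact/tlin_linear/bar_d_multilinear. Qed.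

Lemma bar_d2 (a b : augm A) :
  bar_d (pure [:: a; b]) = - pure [:: augmul a b] :> bar A.
Proof.
rewrite /bar_d tlin_pure; last exact: bar_d_multilinear.
by rewrite big_nat1 expr1 scaleN1r.
Qed.

Section LinearCochain.
Variable f : C.
Hypothesis lf : linear f.

Lemma cinv_multilinear :
  multilinear (fun w => (-1) ^+ size w *: f (pure w)).
Proof.
move=> u v c x y; rewrite !size_cat /= pure_multilinear lf.
by rewrite scalerDr !scalerA mulrC.
Qed.

Lemma cinv_linear : linear (cinv f).
Proof. exact/tlin_linear/cinv_multilinear. Qed.

Lemma cinv_pure w : cinv f (pure w) = (-1) ^+ size w *: f (pure w).
Proof. by rewrite /cinv tlin_pure //; apply: cinv_multilinear. Qed.

Lemma codiff_linear : linear (codiff f).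
Proof. by move=> c x y; rewrite /codiff bar_d_linear cinv_linear opprD scalerN. Qed.

Lemma codiff2 (a b : augm A) :
  codiff f (pure [:: a; b]) = - f (pure [:: augmul a b]).
Proof.
rewrite /codiff bar_d2 (linN cinv_linear) cinv_pure /= expr1 scaleN1r.
by rewrite opprK.
Qed.

End LinearCochain.

Section Product.
Variables f g : C.
Hypotheses (lf : linear f) (lg : linear g).

Lemma cmul_multilinear : multilinear (fun w => \sum_(i < (size w).+1)
    (-1) ^+ (i * (size w - i)) *
      f (pure (take i w)) * g (pure (drop i w)) : k^o).
Proof.
move=> u v c x y; rewrite !size_cat /= scaler_sumr -big_split /=.
apply: eq_bigr => i _; rewrite !take_cat !drop_cat regE.
case: ltnP => [iu|ui].
  rewrite pure_multilinear lg regE mulrDr; congr (_ + _).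
  by rewrite mulrCA.
case: (i - size u)%N => [|m] /=.
  rewrite (pure_multilinear [::]) lg regE mulrDr; congr (_ + _).
  by rewrite mulrCA.
rewrite pure_multilinear lf regE mulrDr mulrDl; congr (_ + _).
by rewrite mulrCA !mulrA.
Qed.

Lemma cmul_linear : linear (cmul f g).
Proof. exact/tlin_linear/cmul_multilinear. Qed.

Lemma cmul_pure w : cmul f g (pure w) = \sum_(i < (size w).+1)
    (-1) ^+ (i * (size w - i)) * f (pure (take i w)) * g (pure (drop i w)).
Proof. by rewrite /cmul tlin_pure //; apply: cmul_multilinear. Qed.

End Product.

Lemma bar_hom_pure (ds : seq nat) (w : seq (augm A)) n s :
  size w = n -> sumn ds = s ->
  all2 (fun d (a : augm A) => val a \in gr A d) ds w ->
  bar_hom n s (pure w).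
Proof. by move=> sw sd h; apply/span_base; exists w, ds. Qed.

Lemma bar_hom0 : bar_hom 0 0 (pure [::] : bar A).
Proof. exact: (@bar_hom_pure [::]). Qed.

Lemma bar_hom1 i (a : piece A i.+1) : bar_hom 1 i.+1 (pure [:: inm a] : bar A).
Proof.
apply: (@bar_hom_pure [:: i.+1]); rewrite //= ?addn0 // inm_val andbT.
exact: (valP a).
Qed.

(** A cochain is only tested on words with homogeneous entries, ds being the
    Adams degrees of the entries of w. *)
Lemma cochP n s (f : C) : linear f ->
  (forall ds w, all2 (fun d (a : augm A) => val a \in gr A d) ds w ->
     (size w, sumn ds) != (n, s) -> f (pure w) = 0) ->
  coch n s f.
Proof.
move=> lf h; split=> // n' s' t ne; move: t; rewrite /bar_hom.
apply: (linear_lspan0 lf) => _ [w [ds [sw sd wd ->]]].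
by apply: (h ds) => //; rewrite sw sd.
Qed.

Lemma coch_pure n s (f : C) ds w : coch n s f ->
  all2 (fun d (a : augm A) => val a \in gr A d) ds w ->
  (size w, sumn ds) != (n, s) -> f (pure w) = 0.
Proof. by move=> [_ h] wd ne; apply: h ne _; apply: (@bar_hom_pure ds). Qed.

Lemma coch_subspace n s : subspace (coch (A := A) n s).
Proof.
split.
  by split=> // c x y; rewrite scaler0 addr0.
move=> c f g [lf hf] [lg hg]; split.
  move=> d x y; rewrite -[(c *: f + g) _]/(c *: f _ + g _) lf lg.
  rewrite -[(c *: f + g) x]/(c *: f x + g x) -[(c *: f + g) y]/(c *: f y + g y).
  by rewrite !scalerDr !scalerA mulrC addrACA.
move=> n' s' t ne tt; rewrite -[(c *: f + g) _]/(c *: f _ + g _).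
by rewrite (hf _ _ _ ne tt) (hg _ _ _ ne tt) scaler0 addr0.
Qed.

Lemma coch_cinv n s (f : C) : coch n s f -> coch n s (cinv f).
Proof.
move=> hf; have lf := hf.1; apply: cochP => [|ds w wd ne].
  exact: cinv_linear.
by rewrite cinv_pure // (coch_pure hf wd ne) scaler0.
Qed.

(** A deconcatenation of a homogeneous word contributes only if its two parts
    have the bidegrees of the two factors. *)
Lemma coch_cmul m n s t (f g : C) :
  coch m s f -> coch n t g -> coch (m + n) (s + t) (cmul f g).
Proof.
move=> hf hg; have lf := hf.1; have lg := hg.1.
apply: cochP => [|ds w wd ne]; first exact: cmul_linear.
rewrite cmul_pure // big1 // => j _; move: (nat_of_ord j) => i {j}.
have sw : size ds = size w by move: wd; rewrite all2E => /andP[/eqP].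
have [wt wdr] : all2 (fun d (a : augm A) => val a \in gr A d) (take i ds) (take i w)
   /\ all2 (fun d (a : augm A) => val a \in gr A d) (drop i ds) (drop i w).
  have si : size (take i ds) = size (take i w) by rewrite !size_take_min sw.
  move: wd; rewrite -{1}(cat_take_drop i ds) -{1}(cat_take_drop i w).
  by rewrite all2_cat // => /andP.
case: (eqVneq (size (take i w), sumn (take i ds)) (m, s)) => [e1|ne1]; last first.
  by rewrite (coch_pure hf wt ne1) mulr0 mul0r.
case: (eqVneq (size (drop i w), sumn (drop i ds)) (n, t)) => [e2|ne2]; last first.
  by rewrite (coch_pure hg wdr ne2) mulr0.
case/eqP: ne; case: e1 => <- <-; case: e2 => <- <-.
by rewrite -size_cat -sumn_cat !cat_take_drop.
Qed.

(** Of the three deconcatenations of [a|b], the two with an empty part vanish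
    for degree reasons; the sign is the Koszul sign of g and a. *)
Lemma cmul_value s t (f g : C) (a b : augm A) : coch 1 s f -> coch 1 t g ->
  cmul f g (pure [:: a; b]) = - (f (pure [:: a]) * g (pure [:: b])).
Proof.
move=> hf hg; have lf := hf.1; have lg := hg.1.
rewrite cmul_pure // !big_ord_recl big_ord0 /=.
rewrite (hf.2 _ _ _ _ bar_hom0) // (hg.2 _ _ _ _ bar_hom0) //.
by rewrite mulr0 mul0r add0r mulr0 !addr0 expr1 mulN1r mulNr.
Qed.

Lemma coch1_piece s i (f : C) (a : piece A i.+1) :
  coch 1 s f -> s != i.+1 -> f (pure [:: inm a]) = 0.
Proof.
move=> hf ne; apply: (hf.2 _ _ _ _ (bar_hom1 a)).
by apply: contra ne => /eqP [->].
Qed.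

Lemma to_bar_bilin j : bilin (fun (a : piece A 1) (b : piece A j.+1) =>
  pure [:: inm a; inm b]).
Proof.
split=> c x y z; rewrite inm_linear.
  by rewrite (pure_multilinear [::]).
by rewrite (pure_multilinear [:: _] [::]).
Qed.

Lemma to_bar_linear j : linear (@to_bar k A j.+1).
Proof. exact/tlift_linear/to_bar_bilin. Qed.

Lemma to_bar_gen j a b :
  @to_bar k A j.+1 (tgen a b) = pure [:: inm a; inm b].
Proof. by rewrite /to_bar tlift_gen //; apply: to_bar_bilin. Qed.

Lemma codiff_to_bar j (g : C) t : linear g ->
  codiff g (to_bar t) = - g (pure [:: inm (@multp k A j.+1 t)]).
Proof.
move=> lg; have lp := pure1_linear (@inm_linear k A j.+1).
move: t; apply: (@tens_ext k _ _ k^o (fun t => codiff g (to_bar t))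
  (fun t => - g (pure [:: inm (@multp k A j.+1 t)]))).
- by move=> c x y; rewrite to_bar_linear codiff_linear.
- by move=> c x y; rewrite multp_linear lp lg opprD scalerN.
move=> a b; rewrite to_bar_gen codiff2 // /multp tlift_gen; last exact: mulp_bilin.
congr (- g (pure [:: _])); apply: val_inj.
by rewrite inm_val /= !inm_val.
Qed.

End Bar.

(** * Merkulov's construction in degrees 1 and 2 *)

Section Model.
Variables (k : fieldType) (A : cgAlg k).
Variable xi : forall s, {linear piece A s -> tens (piece A 1) (piece A s.-1)}.
Hypothesis hxi : splits_mult xi.
Variable R : forall n, set (tens (piece A 1) (piece A n.-1)).
Variable M : merkulov A.
Hypothesis hM : adapted M xi R.
Local Notation C := (cochain A).

Lemma coch2_split s u : coch 2 s u -> exists g h l,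
  [/\ coch 1 s g, mH M 2 s h, mL M 2 s l & u = codiff g + h + l].
Proof.
move=> hu; have [E _] := mT_split M 2 s; move: hu; rewrite E.
move=> [z zZ [l lL <-]]; have [E' _] := mZ_split M 2 s; move: zZ; rewrite E'.
by move=> [_ [g gc <-] [h hH <-]]; exists g, h, l.
Qed.

Lemma coch1_mL s : (2 <= s)%N -> mL M 1 s = coch 1 s.
Proof. by case: hM => _ h _ _ /h[]. Qed.

Lemma multp_xi s (c : piece A s.+2) : multp (xi s.+2 c) = c.
Proof. by apply: val_inj; rewrite val_multp hxi. Qed.

(** The adapted choices make G the transpose of xi, up to sign: the homology
    and the complement L in degree 2 vanish on the image of xi, so that only the
    coboundary part is seen there. *)
Lemma mG_coch s u : coch 2 s.+2 u ->
  coch 1 s.+2 (mG M u) /\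
  forall c : piece A s.+2, mG M u (pure [:: inm c]) = - u (to_bar (xi s.+2 c)).
Proof.
move=> /coch2_split[g [h [l [gc hH lL ->]]]].
have -> : mG M (codiff g + h + l) = g.
  rewrite !raddfD /= (mG_H hH) (mG_L lL) !addr0.
  by apply: (@mG_B _ _ M 1 s.+2); rewrite coch1_mL.
split=> // c.
rewrite -[(codiff g + h + l) _]/(codiff g _ + h _ + l _).
have [_ _ HE LE] := hM.
move: hH; rewrite HE // => -[_ _ ->]; last by exists c.
move: lL; rewrite LE // => -[_ _ ->]; last by exists c.
by rewrite !addr0 codiff_to_bar ?multp_xi ?opprK //; apply: gc.1.
Qed.

(** The operator G lambda_s inside the recursion for lambda, with the
    convention G lambda_1 = - id. *)
Definition glambda b (y : seq C) : C :=
  if size y == 1%N then - head 0 y else mG M (lambda_rec M b y).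

Lemma lambda_recS b x : (size x != 2)%N -> lambda_rec M b.+1 x =
  \sum_(1 <= s < size x) (-1) ^+ s.+1 *:
    cmul (glambda b [seq iter (size x - s).-1 cinv y | y <- take s x])
         (glambda b (drop s x)).
Proof. by move=> /negPf /= ->. Qed.

Lemma coch_iter_cinv m n s (f : C) : coch n s f -> coch n s (iter m cinv f).
Proof. by move=> hf; elim: m => //= m; apply: coch_cinv. Qed.

Lemma iter_cinv1 m s (f : C) a : coch 1 s f ->
  iter m cinv f (pure [:: a]) = (-1) ^+ m * f (pure [:: a]).
Proof.
move=> hf; elim: m => [|m IH] /=; first by rewrite mul1r.
rewrite cinv_pure; last exact: (coch_iter_cinv m hf).1.
by rewrite IH /= expr1 scaleN1r exprS mulN1r mulNr.
Qed.

Lemma coch_opp n s (f : C) : coch n s f -> coch n s (- f).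
Proof.
move=> hf; rewrite -[- f]addr0 -scaleN1r.
by apply: (coch_subspace A n s).2 => //; apply: (coch_subspace A n s).1.
Qed.

(** The bidegree of lambda is a premise, so that this serves inside the
    induction of lambda_coch as well as after it. *)
Lemma glambda_coch b y : (0 < size y)%N ->
  (forall z, z \in y -> coch 1 1 z) ->
  ((1 < size y)%N -> coch 2 (size y) (lambda_rec M b y)) ->
  coch 1 (size y) (glambda b y).
Proof.
case: y => [|f [|g y]] // _ hy hl.
  by apply/coch_opp/hy; rewrite mem_head.
exact: (mG_coch (hl isT)).1.
Qed.

Lemma lambda_coch b (x : seq C) : (1 < size x <= b)%N ->
  (forall y, y \in x -> coch 1 1 y) -> coch 2 (size x) (lambda_rec M b x).
Proof.
elim: b x => [|b IH] x; first by lia.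
move=> sx hx.
case: (eqVneq (size x) 2) => [s2|ns2].
  by rewrite /= s2 /=; apply: (@coch_cmul k A 1 1 1 1); apply/hx/mem_nth;
    rewrite s2.
rewrite lambda_recS // big_nat; have [c0 cS] := coch_subspace A 2 (size x).
apply: (@big_ind _ (coch 2 (size x))) => [|f g hf hg|s slt] //.
  by rewrite -[f]scale1r; apply: cS.
rewrite -[_ *: _]addr0; apply: cS => //.
set y1 := map _ _; set y2 := drop _ _.
have sy1 : size y1 = s by rewrite size_map size_takel //; lia.
have sy2 : size y2 = (size x - s)%N by rewrite size_drop.
have -> : size x = (size y1 + size y2)%N by lia.
have hy1 z : z \in y1 -> coch 1 1 z.
  by move=> /mapP[y /mem_take yx ->]; apply/coch_iter_cinv/hx.
have hy2 z : z \in y2 -> coch 1 1 z by move=> /mem_drop; apply: hx.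
apply: (@coch_cmul k A 1 1); apply: glambda_coch => //.
- by rewrite sy1; lia.
- by move=> ys; apply: IH => //; rewrite ys sy1; lia.
- by rewrite sy2; lia.
- by move=> ys; apply: IH => //; rewrite ys sy2; lia.
Qed.

Lemma glambda_rec_coch b y : (0 < size y <= b)%N ->
  (forall z, z \in y -> coch 1 1 z) -> coch 1 (size y) (glambda b y).
Proof.
move=> /andP[y0 yb] hy; apply: glambda_coch => // y1.
by apply: lambda_coch => //; rewrite y1.
Qed.

Lemma form1_linear (f : C) : linear f -> linear (form1 f : _ -> k^o).
Proof.
by move=> lf c x y; rewrite /form1 (pure1_linear (@inm_linear k A 0)) lf.
Qed.

Lemma form1_tuple_linear n (phi : n.-tuple (piece A 1 -> k)) (x : seq C) :
  (forall y, y \in x -> coch 1 1 y) -> tval phi = map (@form1 k A) x ->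
  forall i, linear (tnth phi i : _ -> k^o).
Proof.
move=> hx ex i; have /mapP[y yx ->] : tnth phi i \in map (@form1 k A) x.
  by rewrite -ex mem_tnth.
exact/form1_linear/(hx _ yx).1.
Qed.

(** Reduces the identity to words [a|c], where both sides are products. *)
Lemma koszul_to_bar n (u : C) (phi : n.+2.-tuple (piece A 1 -> k)) t :
  linear u -> (forall i, linear (tnth phi i : _ -> k^o)) ->
  (forall a c, u (pure [:: inm a; inm c]) =
     (-1) ^+ n.+1 * thead phi a *
       koszul_tensor (behead_tuple phi) (@theta k A xi n.+1 c)) ->
  u (to_bar t) = koszul_tensor phi (rel_incl xi (n := n.+2) t).
Proof.
move=> lu lphi h; move: t.
apply: (@tens_ext k (piece A 1) (piece A n.+1) k^o (fun t => u (to_bar t))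
  (fun t => koszul_tensor phi (rel_incl xi (n := n.+2) t))).
- by move=> c y z; rewrite to_bar_linear lu.
- by move=> c y z; rewrite rel_incl_linear (koszul_linear lphi).
by move=> a c; rewrite to_bar_gen h rel_incl_gen koszul_cons.
Qed.

(** The heart of the proof: on A_1 (x) A_(n-1), lambda_n is the tensor product
    of its arguments. *)
Lemma lambda_value n b (x : seq C) (phi : n.+2.-tuple (piece A 1 -> k)) t :
  (n.+2 <= b)%N -> (forall y, y \in x -> coch 1 1 y) ->
  tval phi = map (@form1 k A) x ->
  lambda_rec M b x (to_bar t) = koszul_tensor phi (rel_incl xi (n := n.+2) t).
Proof.
elim: n b x phi t => [|n IH] [//|b] x phi t nb hx ex.
  have sx : size x = 2 by rewrite -(size_map (@form1 k A)) -ex size_tuple.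
  have lx : (1 < size x <= b.+1)%N by rewrite sx.
  apply: koszul_to_bar => [||a c]; first exact: (lambda_coch lx hx).1.
    exact: form1_tuple_linear hx ex.
  case: x sx hx ex {lx} => [|x0 [|x1 []]] //= _ hx ex.
  have hx1 y : y \in [:: x1] -> coch 1 1 y by move=> yx; apply: hx; rewrite inE yx orbT.
  have ex1 : tval (behead_tuple phi) = map (@form1 k A) [:: x1] by rewrite /= ex.
  rewrite (cmul_value _ _ (hx _ _) (hx1 _ _)) ?mem_head // koszul_pure //; last first.
    exact: form1_tuple_linear hx1 ex1.
  rewrite big_ord1 mul1r (tnth_nth (form1 0)) ex1 /thead (tnth_nth (form1 0)) ex /=.
  by rewrite expr1 mulN1r mulNr.
have sx : size x = n.+3 by rewrite -(size_map (@form1 k A)) -ex size_tuple.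
have lx : (1 < size x <= b.+1)%N by rewrite sx.
apply: koszul_to_bar => [||a c]; first exact: (lambda_coch lx hx).1.
  exact: form1_tuple_linear hx ex.
case: x sx hx ex {lx} => // x0 x [sx] hx ex.
have hx0 : coch 1 1 x0 by apply: hx; rewrite mem_head.
have hx' y : y \in x -> coch 1 1 y by move=> yx; apply: hx; rewrite inE yx orbT.
have ex' : tval (behead_tuple phi) = map (@form1 k A) x by rewrite /= ex.
have -> : thead phi a = x0 (pure [:: inm a]).
  by rewrite /thead (tnth_nth (form1 0)) ex.
have lx' : (1 < size x <= b)%N by rewrite sx.
have hl := lambda_coch lx' hx'; rewrite sx in hl.
have [gc gv] := mG_coch hl.
rewrite thetaSS -(IH b x) // lambda_recS; last by rewrite /= sx.
rewrite [size _]/= sx big_ltn //.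
rewrite -[(_ + _) _]/(_ *: (cmul _ _ _) + _) /=.
(* A cochain on A_s with s >= 2 vanishes on the first entry, which is in A_1. *)
have -> : (\sum_(2 <= s < n.+3) (-1) ^+ s.+1 *:
    cmul (glambda b [seq iter (n.+3 - s).-1 cinv y | y <- take s (x0 :: x)])
         (glambda b (drop s (x0 :: x)))) (pure [:: inm a; inm c]) = 0.
  rewrite big_nat; apply: (@big_ind _ (fun g : C => g (pure [:: inm a; inm c]) = 0)).
  - by [].
  - by move=> f g hf hg; rewrite -[(f + g) _]/(f _ + g _) hf hg addr0.
  move=> s slt; set y1 := map _ _; set y2 := drop _ _.
  have sy1 : size y1 = s by rewrite size_map size_takel //= sx; lia.
  have sy2 : size y2 = (n.+3 - s)%N by rewrite size_drop /= sx.
  have h1 : coch 1 s (glambda b y1).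
    rewrite -sy1; apply: glambda_rec_coch => [|z]; first by rewrite sy1; lia.
    by move=> /mapP[y /mem_take yx ->]; apply/coch_iter_cinv/hx.
  have h2 : coch 1 (n.+3 - s) (glambda b y2).
    rewrite -sy2; apply: glambda_rec_coch => [|z]; first by rewrite sy2; lia.
    by move=> /mem_drop; apply: hx.
  rewrite -[LHS]/(_ *: cmul _ _ _) (cmul_value _ _ h1 h2) (coch1_piece _ h1).
    by rewrite mul0r oppr0 scaler0.
  by lia.
rewrite addr0 take0 drop0 sqrrN expr1n scale1r.
have ci : coch 1 1 (iter n.+1 cinv x0) by apply: coch_iter_cinv.
have -> : glambda b x = mG M (lambda_rec M b x) by rewrite /glambda sx.
rewrite (cmul_value _ _ (coch_opp ci) gc) gv mulrN opprK.
rewrite -[(- _) _]/(- (iter n.+1 cinv x0 _)) (iter_cinv1 _ _ hx0).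
by rewrite [in RHS]exprS mulN1r !mulNr.
Qed.

End Model.

Theorem corollaryB (k : fieldType) (A : cgAlg k)
  (hfin : fin_dim (piece A 1)) (hgen : generated_in_degree1 A)
  (xi : forall s, {linear piece A s -> tens (piece A 1) (piece A s.-1)})
  (hxi : splits_mult xi)
  (R : forall n, set (tens (piece A 1) (piece A n.-1)))
  (hR : relation_space xi R)
  (M : merkulov A) (hM : adapted M xi R)
  (n : nat) (hn : (2 <= n)%N)
  (f : n.-tuple (cochain A)) (hf : forall i, mH M 1 1 (tnth f i)) :
  mH M 2 n (mop M f) /\
  forall r, R n r ->
    mop M f (to_bar r) = koszul_tensor (map_tuple (@form1 k A) f) (rel_incl xi r).
Proof.
case: n hn f hf => [|[|n]] // _ f hf.
have fc y : y \in tval f -> coch 1 1 y.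
  by move=> /tnthP[i ->]; case: hM => -[<- _] _ _ _.
have lc : coch 2 n.+2 (lambda M f).
  rewrite -[X in coch _ X](size_tuple f); apply: (lambda_coch hxi hM) => //.
  by rewrite size_tuple /=.
have [g [h [l [gc hH lL lE]]]] := coch2_split M lc.
(* The projection keeps the H-component h of lambda = codiff g + h + l. *)
have -> : mop M f = h.
  rewrite /mop size_tuple /= lE !raddfD /= (mpr_H hH) (mpr_L lL) addr0.
  by rewrite (@mpr_B _ _ M 2 n.+2) ?add0r //; exists g.
split=> // r Rr.
have <- : lambda M f (to_bar r) = h (to_bar r).
  rewrite lE -[(codiff g + h + l) _]/(codiff g _ + h _ + l _).
  (* l vanishes on R, and codiff g on every tensor with product 0. *)
  have [_ _ _ LE] := hM; move: lL; rewrite LE // => -[_ lR _]; rewrite lR; last by exists r.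
  rewrite codiff_to_bar ?(multp_relation hxi hR Rr); last exact: gc.1.
  rewrite (lin0 (@inm_linear k A n.+1)).
  rewrite (lin0 (pure1_linear (h := id) _)) // (lin0 gc.1).
  by rewrite oppr0 add0r addr0.
by apply: (lambda_value hxi hM); rewrite ?size_tuple.
Qed.
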